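(* Let $f$ be a homogeneous even symmetric function. Suppose that there is a fixed $\varepsilon>0$ such that $f(x)\geq\varepsilon$ for all $x\in\mathbb{R}^\infty$ with $p_2(x)=1$. Then there exists $k\in\mathbb{N}$ such that $p_2^k f$ is a linear combination of even monomial symmetric functions with only non-negative coefficients. In particular, $p_2^k f$ is an any-dimensional sum of squares.
   Context: $\mathbb{N}$ denotes the positive integers. For $k\geq 1$ let $p_k=\sum_{i=1}^\infty X_i^k$ be the $k$-th power sum function in countably many variables $X_1,X_2,\ldots$, and let $\Lambda=\mathbb{R}[p_1,p_2,\ldots]$ be the ring of symmetric functions over $\mathbb{R}$ (a subring of the formal power series ring $\mathbb{R}[[X_1,X_2,\ldots]]$; every element has bounded degree, and $p_k$ is homogeneous of degree $k$). For $f\in\Lambda$, $f^{(n)}=f(X_1,\ldots,X_n,0,0,\ldots)\in\mathbb{R}[X_1,\ldots,X_n]$ denotes its truncation to $n$ variables. $\mathbb{R}^\infty$ is the set of real sequences $(x_1,x_2,\ldots)$ with only finitely many non-zero entries; symmetric functions are evaluated on it in the obvious way. A symmetric function is even if every monomial occurring in it has even degree in each variable. For a partition $\lambda=(\lambda_1,\ldots,\lambda_\ell)$ the monomial symmetric function is $m_\lambda=\sum X_{i_1}^{\lambda_1}\cdots X_{i_\ell}^{\lambda_\ell}$, summed over all distinct monomials obtainable by permuting the indices of the variables; it is even if all parts $\lambda_i$ are even. A symmetric function $g$ is an any-dimensional sum of squares if, for every $n\in\mathbb{N}$, $g^{(n)}$ is a sum of squares of polynomials in $\mathbb{R}[X_1,\ldots,X_n]$.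 *)

(* Defs.v *)
From HB Require Import structures.
From mathcomp Require Import all_boot all_order all_algebra.
From mathcomp Require Import finmap.
From mathcomp Require Import mathcomp_extra boolp classical_sets functions.
From mathcomp Require Import cardinality fsbigop reals.
(* Both [monalg] and [mpoly] define {mpoly R[n]} and 'X_{1..n}; those of      *)
(* [mpoly] are the ones in use here.                                          *)
From mathcomp Require Import -(notations) monalg.
From mathcomp Require Import mpoly.

Set Implicit Arguments.
Unset Strict Implicit.
Unset Printing Implicit Defensive.

Import Order.TTheory GRing.Theory Num.Theory.

Local Open Scope classical_set_scope.
Local Open Scope ring_scope.

(* Monomials in countably many variables. Indices start at 0, so the variable *)
(* of index i stands for X_(i+1).                                             *)
Notation monom := (cmonom nat).
Notation monom1 := (@onecm nat).
Notation monom_mul := (@mulcm nat).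
Notation monom_deg := (@monalg.mdeg nat).

Definition monomX (i k : nat) : monom := expcmn (ucm i) k.

Definition monom_of n (m : 'X_{1..n}) : monom :=
  \big[monom_mul/monom1]_(i < n) monomX i (m i).

(* A formal power series is the family of its coefficients.                   *)
Definition fpseries (R : Type) : Type := monom -> R.

Section PSeriesRing.
Variable R : comNzRingType.
Implicit Types (f g h : fpseries R) (m : monom).

HB.instance Definition _ := GRing.Lmodule.copy (fpseries R) (monom -> R^o).

Definition fpseries1 : fpseries R := fun m => (m == monom1)%:R.

(* The sum is finite, since a monomial has finitely many divisors.            *)
Definition fpseries_mul f g : fpseries R := fun m =>
  \sum_(p \in [set p : monom * monom | monom_mul p.1 p.2 = m]) f p.1 * g p.2.

Let finite_divisors m :
  exists E : {fset monom}, forall a b, monom_mul a b = m -> a \in E.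
Proof.
pose d := finsupp m; pose N := (monom_deg m).+1.
pose F (h : {ffun d -> 'I_N}) : monom :=
  cmonom_of_fsfun cmonom_key [fsfun i : d => nat_of_ord (h i) | 0%N].
exists [fset F h | h in {: {ffun d -> 'I_N}}]%fset => a b abm.
have le_am i : (a i <= m i)%N by rewrite -abm mulcmE leq_addr.
have lt_aN (i : d) : (a (val i) < N)%N.
  rewrite ltnS (leq_trans (le_am _))// /monalg.mdeg.
  by rewrite (big_fsetD1 (val i)) ?fsvalP//= leq_addr.
apply/imfsetP; exists [ffun i => Ordinal (lt_aN i)]; first by rewrite inE.
apply/eqP/cmP => i; rewrite /F cmE fsfun_ffun.
case: insubP => [u _ <-|]; first by rewrite /= ffunE.
by rewrite memNfinsupp => /eqP mi0; apply/eqP; rewrite -leqn0 -{2}mi0.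
Qed.

Let fpseries_mulE (E : {fset monom}) f g m :
    (forall a b, monom_mul a b = m -> a \in E) ->
  fpseries_mul f g m =
    \sum_(a <- E) \sum_(b <- E) (f a * g b) *+ (monom_mul a b == m).
Proof.
move=> Em; pose r := [seq (a, b) | a <- E, b <- E].
transitivity (\sum_(p <- r | monom_mul p.1 p.2 == m) f p.1 * g p.2); last first.
  rewrite big_mkcond big_allpairs_dep; apply: eq_bigr => a _.
  by apply: eq_bigr => b _ /=; case: eqP.
rewrite bigfs.
- by congr (\sum_(p \in _) _); apply/seteqP; split=> p /= /eqP.
- by rewrite allpairs_uniq// => -[? ?] [? ?].
move=> [a b] /= /eqP abm /negP[]; apply/allpairsP; exists (a, b) => /=.
by split=> //; [apply: Em abm | apply: (Em b a); rewrite mulcmC].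
Qed.

Let fpseries_mulC : commutative fpseries_mul.
Proof.
move=> f g; apply/funext => m; have [E Em] := finite_divisors m.
rewrite !(fpseries_mulE _ _ Em) exchange_big; apply: eq_bigr => a _.
by apply: eq_bigr => b _ /=; rewrite mulcmC mulrC.
Qed.

Let fpseries_mulA : associative fpseries_mul.
Proof.
have assoc_sum f g h m (E : {fset monom}) :
    (forall a b, monom_mul a b = m -> a \in E) ->
  fpseries_mul f (fpseries_mul g h) m =
  \sum_(a <- E) \sum_(b <- E) \sum_(c <- E)
     (f a * g b * h c) *+ (monom_mul a (monom_mul b c) == m).
- move=> Em; rewrite (fpseries_mulE _ _ Em); apply: eq_bigr => a _.
  transitivity (\sum_(t <- E) \sum_(b <- E) \sum_(c <- E)
     (f a * g b * h c) *+ ((monom_mul a t == m) && (monom_mul b c == t))).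
    apply: eq_bigr => t _; case: eqP => [atm|_] /=; last first.
      by rewrite mulr0n big1// => b _; rewrite big1// => c _; rewrite mulr0n.
    rewrite mulr1n (@fpseries_mulE E) => [|b c bct]; last first.
      by apply: (Em _ (monom_mul c a)); rewrite mulcmA bct mulcmC.
    rewrite mulr_sumr; apply: eq_bigr => b _.
    by rewrite mulr_sumr; apply: eq_bigr => c _; rewrite mulrnAr mulrA.
  rewrite exchange_big; apply: eq_bigr => b _ /=.
  rewrite exchange_big; apply: eq_bigr => c _ /=.
  have [abcm|abcm] := eqVneq (monom_mul a (monom_mul b c)) m; last first.
    rewrite mulr0n big1// => t _; case: eqVneq => //= atm; case: eqVneq => // bct.
    by rewrite bct atm eqxx in abcm.
  rewrite (big_fsetD1 (monom_mul b c)) /=; last first.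
    by apply: (Em _ a); rewrite mulcmC.
  rewrite abcm !eqxx big_seq big1 ?addr0// => t; rewrite !inE eq_sym => /andP[].
  by move=> /negPf -> _; rewrite andbF.
move=> f g h; apply/funext => m; have [E Em] := finite_divisors m.
rewrite (assoc_sum _ _ _ _ _ Em) [in RHS]fpseries_mulC (assoc_sum _ _ _ _ _ Em).
rewrite [RHS]exchange_big; apply: eq_bigr => a _ /=.
rewrite [RHS]exchange_big; apply: eq_bigr => b _ /=.
apply: eq_bigr => c _; rewrite [monom_mul c _]mulcmC mulcmA.
by rewrite -[X in _ = X *+ _]mulrA mulrC.
Qed.

Let fpseries_mul1 : left_id fpseries1 fpseries_mul.
Proof.
move=> f; apply/funext => m; have [E Em] := finite_divisors m.
rewrite (fpseries_mulE _ _ Em) (big_fsetD1 monom1) /=; last first.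
  by apply: (Em _ m); rewrite mul0cm.
rewrite [X in _ + X]big_seq [X in _ + X]big1 ?addr0; last first.
  move=> a; rewrite !inE => /andP[/negPf a1 _]; rewrite big1// => b _.
  by rewrite /fpseries1 a1 mul0r mul0rn.
rewrite (big_fsetD1 m) /=; last by apply: (Em _ monom1); rewrite mulcm0.
rewrite big_seq big1 ?addr0; last first.
  by move=> a; rewrite !inE mul0cm => /andP[/negPf ->]; rewrite mulr0n.
by rewrite mul0cm /fpseries1 !eqxx mul1r.
Qed.

Let fpseries_mulDl : left_distributive fpseries_mul +%R.
Proof.
move=> f g h; apply/funext => m; have [E Em] := finite_divisors m.
have addE (u v : fpseries R) k : (u + v) k = u k + v k by [].
rewrite addE !(fpseries_mulE _ _ Em) -big_split; apply: eq_bigr => a _ /=.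
by rewrite -big_split; apply: eq_bigr => b _; rewrite addE mulrDl mulrnDl.
Qed.

Let fpseries1_neq0 : fpseries1 != 0.
Proof.
apply/eqP => /(congr1 (fun f : fpseries R => f monom1)) /eqP.
by rewrite /fpseries1 eqxx oner_eq0.
Qed.

HB.instance Definition _ := GRing.Zmodule_isComNzRing.Build (fpseries R)
  fpseries_mulA fpseries_mulC fpseries_mul1 fpseries_mulDl fpseries1_neq0.

Let fpseries_scaleAl (c : R) f g : c *: (f * g) = (c *: f) * g.
Proof.
apply/funext => m; have [E Em] := finite_divisors m.
have scaleE (u : fpseries R) k : (c *: u) k = c * u k by [].
have mulE (u v : fpseries R) : u * v = fpseries_mul u v by [].
rewrite scaleE !mulE !(fpseries_mulE _ _ Em).
rewrite mulr_sumr; apply: eq_bigr => a _; rewrite mulr_sumr.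
by apply: eq_bigr => b _; rewrite scaleE mulrnAr mulrA.
Qed.

HB.instance Definition _ :=
  GRing.Lmodule_isLalgebra.Build R (fpseries R) fpseries_scaleAl.

End PSeriesRing.

Section SymmetricFunctions.
Variable R : realType.
Implicit Types (f g : fpseries R) (m : monom).

(* The power sum p_k, meaningful for k >= 1.                                  *)
Definition psum (k : nat) : fpseries R :=
  fun m => `[< exists i, m = monomX i k >]%:R.

(* The subring R[p_1, p_2, ...] of the ring of formal power series.           *)
Inductive symfun : fpseries R -> Prop :=
  | symfun_const (c : R) : symfun c%:A
  | symfun_psum (k : nat) of (0 < k)%N : symfun (psum k)
  | symfun_add f g of symfun f & symfun g : symfun (f + g)
  | symfun_mul f g of symfun f & symfun g : symfun (f * g).

(* Setting X_(n+1), X_(n+2), ... to 0. The support of the sum is finite as    *)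
(* soon as f has bounded degree.                                              *)
Definition ps_trunc n f : {mpoly R[n]} :=
  \sum_(m \in [set: 'X_{1..n}]) f (monom_of m) *: 'X_[m].

(* Evaluation at a finitely supported sequence; again the support of the sum  *)
(* is finite when f has bounded degree.                                       *)
Definition ps_eval f (x : {fsfun nat -> R with 0}) : R :=
  \sum_(m \in [set: monom]) f m * \prod_(i <- finsupp m) x i ^+ m i.

Definition ps_homog (d : nat) f := forall m, f m != 0 -> monom_deg m = d.

Definition ps_even f := forall m, f m != 0 -> forall i, ~~ odd (m i).

Definition is_partition (la : seq nat) := sorted geq la && (0%N \notin la).

(* m_la is the sum of all monomials whose nonzero exponents are, up to        *)
(* reordering, the parts of la.                                               *)
Definition monomial_symfun (la : seq nat) : fpseries R :=
  fun m => (perm_eq [seq m i | i <- finsupp m] la)%:R.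

Definition any_dim_sos f := forall n, (0 < n)%N ->
  exists s : seq {mpoly R[n]}, ps_trunc n f = \sum_(q <- s) q ^+ 2.

End SymmetricFunctions.

Arguments psum {R} k.
Arguments monomial_symfun {R} la.

(* Main.v *)
Require Import Defs.
From mathcomp Require Import all_boot all_order all_algebra.
From mathcomp Require Import finmap reals.
From mathcomp Require Import boolp classical_sets fsbigop.
From mathcomp Require Import -(notations) monalg.
From mathcomp Require Import perm mpoly ring lra zify.

(** The proof is Polya's, run so that no estimate sees the number of variables.

    Since [f] is even, its truncation to [n] variables is [q (X_1^2, ..., X_n^2)]
    with [q] homogeneous of degree [e = d / 2], and the hypothesis on [f] says
    that [q >= eps] on the standard simplex (evaluate [f] at square roots).
    Write [s = X_1 + ... + X_n]. For a monomial [X^b] of degree [M = N + e] the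
    coefficients of [s^N * p] are given exactly by falling factorials
    ([mcoeff_sumX_exp_mul]):
      [b! * (s^N * p)_b = N! * L_b(p)], where [L_b (X^a) = prod_i b_i ^_ a_i].
    So [L_b] is a discrete version of evaluation at [b]; it never exceeds
    evaluation on polynomials with nonnegative coefficients. Let [A] bound the
    coefficients of [q] from above. As all coefficients of [s^e] are at least 1,
    [A s^e - q] has nonnegative coefficients, hence
      [A (M ^_ e) - L_b(q) = L_b(A s^e - q) <= A M^e - q(b) <= (A - eps) M^e].
    Here [M^e - M ^_ e <= (e^2 / M) M^e], so [L_b(q) >= 0] once
    [A e^2 <= eps * N]: this is [uniform_Polya].

    The bound involves only [A], [e] and [eps]. A symmetric function that is
    homogeneous has finitely many distinct coefficients, one for each partition
    of its degree ([even_symfun_expansion]), so one [A], and hence one exponent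
    [N], serves for every [n]. Therefore all coefficients of [p_2^N f] are
    nonnegative. Collecting them by partition gives the combination of monomial
    symmetric functions, and each truncation is a sum of terms [c X^(2a)] with
    [c >= 0], which are squares. *)

Set Implicit Arguments.
Unset Strict Implicit.
Unset Printing Implicit Defensive.

Import Order.TTheory GRing.Theory Num.Theory.
Local Open Scope ring_scope.

(** * A version of Polya's theorem uniform in the number of variables *)

Section Polya.
Variables (R : realFieldType) (n : nat).
Implicit Types (p q : {mpoly R[n]}) (a b m : 'X_{1..n}).

Local Notation sumX := (\sum_(i < n) 'X_i : {mpoly R[n]}).

Lemma mcoeff_sumX_mul p b :
  (sumX * p)@_b = \sum_(i < n | (0 < b i)%N) p@_(b - U_(i)).
Proof.
rewrite mulr_suml raddf_sum [RHS]big_mkcond; apply: eq_bigr => i _ /=.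
rewrite mulrC; case: ifPn => [bi|].
  have bE : (U_(i) + (b - U_(i)))%MM = b.
    apply/mnmP => j; rewrite mnmDE mnmBE mnm1E.
    by case: eqP => [<-|_] /=; rewrite ?add0n ?subn0// subnKC.
  by rewrite -{1}bE mcoeffMX.
rewrite -eqn0Ngt => /eqP bi; apply/eqP; rewrite mcoeff_eq0.
rewrite (perm_mem (msuppMX _ _)); apply/mapP => -[m _ bE].
by move: bi; rewrite bE mnmDE mnm1E eqxx.
Qed.

Lemma dhomog_sumX : sumX \is 1.-homog.
Proof. by apply: rpred_sum => i _; rewrite dhomogX /= mdeg1. Qed.

Lemma dhomog_sumX_exp N : sumX ^+ N \is N.-homog.
Proof. by have := dhomogMn N dhomog_sumX; rewrite mul1n. Qed.

Lemma dhomog_sumX_mul N e p : p \is e.-homog -> sumX ^+ N * p \is (N + e).-homog.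
Proof. by move=> hp; apply: dhomogM => //; apply: dhomog_sumX_exp. Qed.

Lemma prod_ffact_eq0 b m : ~~ [forall i, m i <= b i]%N ->
  (\prod_i b i ^_ m i = 0)%N.
Proof.
rewrite negb_forall => /existsP[i]; rewrite -ltnNge => lt_bm.
by rewrite (bigD1 i)//= ffact_small.
Qed.

Lemma prod_ffact_deg b m :
  (\sum_i (b i - m i) * \prod_i b i ^_ m i
     = (mdeg b - mdeg m) * \prod_i b i ^_ m i)%N.
Proof.
rewrite -big_distrl/=.
have [le_mb|/prod_ffact_eq0->] := boolP [forall i, m i <= b i]%N; last by rewrite !muln0.
by congr (_ * _)%N; rewrite !mdegE -sumnB// => i _; exact: (forallP le_mb).
Qed.

(** The Pascal-type rule behind the induction on the power of the sum of the
    variables: summed over [i], the factors [b i - m i] add up to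
    [mdeg b - mdeg m]. *)
Lemma prod_ffact_pred b m i : (0 < b i)%N ->
  (b i * \prod_j (b - U_(i))%MM j ^_ m j = (b i - m i) * \prod_j b j ^_ m j)%N.
Proof.
move=> b_gt0; rewrite (bigD1 i)//= [in RHS](bigD1 i)//= !mulnA; congr (_ * _)%N.
  rewrite mnmBE mnm1E eqxx subn1 mulnC [RHS]mulnC -ffactnSr ffactnS mulnC.
  by [].
by apply: eq_bigr => j ji; rewrite mnmBE mnm1E eq_sym (negbTE ji) subn0.
Qed.

Lemma prod_fact_pred b i : (0 < b i)%N ->
  (\prod_j (b j)`! = b i * \prod_j ((b - U_(i))%MM j)`!)%N.
Proof.
move=> b_gt0; rewrite (bigD1 i)//= [in RHS](bigD1 i)//= !mulnA; congr (_ * _)%N.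
  by rewrite mnmBE mnm1E eqxx subn1 -[in LHS](prednK b_gt0) factS prednK.
by apply: eq_bigr => j ji; rewrite mnmBE mnm1E eq_sym (negbTE ji) subn0.
Qed.

(** Induction on [N]: multiplying by the sum of the variables adds up the
    coefficients at the predecessors of [b], and [prod_ffact_pred] turns that
    sum into multiplication by [N.+1]. For [N = 0] a falling factorial product
    with [mdeg m = mdeg b] vanishes unless [m = b]. *)
Lemma mcoeff_sumX_exp_mul e N p b : p \is e.-homog -> mdeg b = (N + e)%N ->
  (\prod_i (b i)`!)%N%:R * (sumX ^+ N * p)@_b =
  N`!%:R * \sum_(m <- msupp p) p@_m * (\prod_i b i ^_ m i)%N%:R.
Proof.
move=> hp; elim: N b => [|N IHN] b bE.
  rewrite expr0 !mul1r.
  have b0 m : m \in msupp p -> m != b -> (\prod_i b i ^_ m i = 0)%N.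
    move=> mp mb; apply: prod_ffact_eq0; apply: contraNN mb => /forallP le_mb.
    have degmb : mdeg (b - m)%MM = 0%N.
      rewrite mdegE; under eq_bigr do rewrite mnmBE.
      by rewrite sumnB// -!mdegE bE (dhomog_mf hp mp) subnn.
    apply/eqP/mnmP => i; apply/eqP; rewrite eqn_leq le_mb/=.
    move/eqP: degmb; rewrite mdeg_eq0 => /eqP/mnmP/(_ i).
    by rewrite mnmBE mnm0E => /eqP.
  have [bp|bp] := boolP (b \in msupp p); last first.
    rewrite (eqP (_ : p@_b == 0)) ?mcoeff_eq0// mulr0 big_seq big1// => m mp.
    by rewrite (b0 m) ?mulr0//; apply: contraNneq bp => <-.
  rewrite [RHS](bigD1_seq b)//= [X in _ + X]big_seq_cond.
  rewrite [X in _ + X]big1 => [|m /andP[mp mb]]; last first.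
    by rewrite (b0 m)// mulr0.
  by rewrite addr0 mulrC; under [in RHS]eq_bigr do rewrite ffactnn.
rewrite exprS -mulrA mcoeff_sumX_mul [LHS]mulr_sumr.
have deg_pred i : (0 < b i)%N -> mdeg (b - U_(i))%MM = (N + e)%N.
  move=> bi; have le_Ub : (U_(i) <= b)%MM.
    by apply/mnm_lepP => j; rewrite mnm1E; case: eqP => // <-.
  apply/eqP; rewrite -(eqn_add2r 1) -[X in (_ + X)%N](mdeg1 i) -mdegD submK//.
  by rewrite bE addSn addn1.
transitivity (\sum_(i < n | (0 < b i)%N) N`!%:R *
    \sum_(m <- msupp p) p@_m * ((b i - m i) * \prod_j b j ^_ m j)%N%:R).
  apply: eq_bigr => i bi.
  rewrite (prod_fact_pred bi) natrM -mulrA (IHN _ (deg_pred _ bi)) mulrCA; congr (_ * _).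
  rewrite mulr_sumr.
  by apply: eq_bigr => m _; rewrite mulrCA -natrM prod_ffact_pred.
rewrite -mulr_sumr factS natrM -mulrA mulrCA; congr (_ * _).
rewrite exchange_big/= mulr_sumr big_seq [RHS]big_seq; apply: eq_bigr => m mp.
rewrite -mulr_sumr mulrCA; congr (_ * _); rewrite -natr_sum -natrM; congr (_%:R).
rewrite big_mkcond/=; under eq_bigr => i _.
  have -> : (if (0 < b i)%N then ((b i - m i) * \prod_j b j ^_ m j)%N else 0%N)
    = ((b i - m i) * \prod_j b j ^_ m j)%N by case: posnP => // ->.
  over.
by rewrite prod_ffact_deg bE (dhomog_mf hp mp) addSn -addSn addnK.
Qed.

Lemma prod_fact_le b : (\prod_i (b i)`! <= (mdeg b)`!)%N.
Proof.
rewrite mdegE; elim/big_ind2: _ => // x1 x2 y1 y2 le1 le2.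
rewrite (leq_trans (leq_mul le1 le2))//.
by rewrite -(bin_fact (leq_addr y1 x1)) addKn leq_pmull// bin_gt0 leq_addr.
Qed.

Lemma mcoeff_sumX_exp e b : mdeg b = e ->
  (\prod_i (b i)`!)%N%:R * (sumX ^+ e)@_b = e`!%:R.
Proof.
move=> bE; rewrite -[sumX ^+ e]mulr1 (mcoeff_sumX_exp_mul (e := 0))//; last 2 first.
- exact: dhomog1.
- by rewrite addn0.
rewrite -mpolyC1 msupp1 big_seq1 mcoeffC eqxx big1 ?mulr1// => i _.
by rewrite mnm0E ffactn0.
Qed.

Lemma ge1_mcoeff_sumX_exp e b : mdeg b = e -> 1 <= (sumX ^+ e)@_b.
Proof.
move=> bE; have b_gt0 : 0 < (\prod_i (b i)`!)%N%:R :> R.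
  by rewrite ltr0n prodn_gt0// => i; rewrite fact_gt0.
rewrite -(ler_pM2l b_gt0) mcoeff_sumX_exp// mulr1 ler_nat -bE.
exact: prod_fact_le.
Qed.

Lemma dhomog_meval_scale e p (c : R) v : p \is e.-homog ->
  p.@[fun i => c * v i] = c ^+ e * p.@[v].
Proof.
move=> hp; rewrite !mevalE mulr_sumr big_seq [RHS]big_seq.
apply: eq_bigr => m mp; rewrite mulrCA; congr (_ * _).
under eq_bigr do rewrite exprMn; rewrite big_split/= prodrXr; congr (_ ^+ _ * _).
by rewrite -mdegE; apply: dhomog_mf mp.
Qed.

Lemma ffact_le_exp M e : (M ^_ e <= M ^ e)%N.
Proof.
elim: e => // e IHe; rewrite ffactnSr expnSr.
by rewrite leq_mul// leq_subr.
Qed.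

(** This is [M^e - M ^_ e <= (e^2 / M) M^e] without subtraction or division. *)
Lemma ffact_ge M e : (M ^ e * M <= M ^_ e * M + e ^ 2 * M ^ e)%N.
Proof.
elim: e => [|e IHe]; first by rewrite leq_addr.
rewrite ffactnSr expnSr.
have sub_e : (M ^_ e * M <= M ^_ e * (M - e) + M ^_ e * e)%N.
  by rewrite -mulnDr leq_mul2l; apply/orP; right; lia.
have le_e : (M ^_ e * e <= M ^ e * e)%N by rewrite leq_mul2r ffact_le_exp orbT.
have le1 := leq_mul (leq_trans sub_e (leq_add (leqnn _) le_e)) (leqnn M).
have le2 := leq_mul IHe (leqnn M).
rewrite (leq_trans le2)// mulnDl (leq_trans (leq_add le1 (leqnn _)))//.
rewrite mulnDl -addnA leq_add2l.
rewrite (_ : e.+1 ^ 2 = e ^ 2 + e * 2 + 1)%N; last by ring.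
nia.
Qed.

(** The conditions on [N] do not mention [n]. The polynomial
    [G := A *: sumX ^+ e - p] has nonnegative coefficients, so its
    falling-factorial functional at [b] is at most its value at [b]. *)
Theorem uniform_Polya e p (A eps : R) N : p \is e.-homog ->
  (forall m, p@_m <= A) -> 0 <= A ->
  (forall y : 'I_n -> R, (forall i, 0 <= y i) -> \sum_i y i = 1 ->
     eps <= p.@[y]) ->
  (0 < N)%N -> A * (e ^ 2)%:R <= eps * N%:R ->
  forall b, 0 <= (sumX ^+ N * p)@_b.
Proof.
move=> hp pA A_ge0 p_ge N_gt0 N_large b.
have [bE|bE] := eqVneq (mdeg b) (N + e)%N; last first.
  by rewrite (dhomog_nemf_coeff (dhomog_sumX_mul N hp) bE).
pose M := (N + e)%N; have M_gt0 : (0 < M)%N by rewrite addn_gt0 N_gt0.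
pose G := A *: sumX ^+ e - p.
have hG : G \is e.-homog.
  apply: rpredB => //; apply: rpredZ; exact: dhomog_sumX_exp.
have eps_ge0 : 0 <= eps.
  have Nr_gt0 : 0 < N%:R :> R by rewrite ltr0n.
  by rewrite -(pmulr_lge0 _ Nr_gt0) (le_trans _ N_large)// mulr_ge0.
have b_gt0 : 0 < (\prod_i (b i)`!)%N%:R :> R.
  by rewrite ltr0n prodn_gt0// => i; rewrite fact_gt0.
have G_ge0 m : 0 <= G@_m.
  have [mE|mE] := eqVneq (mdeg m) e; last by rewrite (dhomog_nemf_coeff hG mE).
  rewrite mcoeffB mcoeffZ subr_ge0 (le_trans (pA m))// ler_peMr//.
  exact: ge1_mcoeff_sumX_exp.
have GE : (\prod_i (b i)`!)%N%:R * (sumX ^+ N * G)@_b =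
    A * M`!%:R - (\prod_i (b i)`!)%N%:R * (sumX ^+ N * p)@_b.
  rewrite mulrBr -scalerAr -exprD mcoeffB mcoeffZ mulrBr; congr (_ - _).
  by rewrite mulrCA mcoeff_sumX_exp.
have le_G : \sum_(m <- msupp G) G@_m * (\prod_i b i ^_ m i)%N%:R <=
    G.@[fun i => (b i)%:R].
  rewrite mevalE; apply: ler_sum => m _; rewrite ler_wpM2l//.
  rewrite natr_prod; apply: ler_prod => i _.
  by rewrite ler0n -natrX ler_nat ffact_le_exp.
(* Scaling by M moves the lower bound from the simplex to the point b. *)
have p_b : eps * M%:R ^+ e <= p.@[fun i => (b i)%:R].
  have M0 : M%:R != 0 :> R by rewrite pnatr_eq0 -lt0n.
  have -> : p.@[fun i => (b i)%:R] = M%:R ^+ e * p.@[fun i => M%:R^-1 * (b i)%:R].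
    rewrite -dhomog_meval_scale//; apply: meval_eq => i /=.
    by rewrite mulrA mulfV// mul1r.
  rewrite mulrC ler_wpM2l ?exprn_ge0// p_ge// => [i|].
    by rewrite mulr_ge0// invr_ge0.
  by rewrite -mulr_sumr -natr_sum -mdegE bE mulVf.
have sum_b : (sumX ^+ e).@[fun i => (b i)%:R] = M%:R ^+ e :> R.
  rewrite rmorphXn/= raddf_sum/=; under eq_bigr do rewrite mevalXU.
  by rewrite -natr_sum -mdegE bE.
have fact_M : M`!%:R = N`!%:R * (M ^_ e)%:R :> R.
  by rewrite -natrM mulnC -(ffact_fact (leq_addl N e)) addnK.
rewrite -(pmulr_rge0 _ b_gt0).
have := ler_wpM2l (ler0n R N`!) le_G.
rewrite -(mcoeff_sumX_exp_mul hG bE) GE mevalB mevalZ sum_b fact_M.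
set c := (\prod_i _)%:R * _ => cE.
have bound : A * M%:R ^+ e - A * (M ^_ e)%:R <= eps * M%:R ^+ e.
  have Mr_gt0 : 0 < M%:R :> R by rewrite ltr0n.
  rewrite -(ler_pM2r Mr_gt0).
  have := ffact_ge M e; rewrite -(ler_nat R) natrD !natrM natrX => fM.
  have : A * (e ^ 2)%:R * M%:R ^+ e <= eps * M%:R * M%:R ^+ e.
    by rewrite ler_wpM2r ?exprn_ge0// (le_trans N_large)// ler_wpM2l// ler_nat leq_addr.
  have := ler_wpM2l A_ge0 fM.
  nra.
have : N`!%:R * (A * M%:R ^+ e - eps * M%:R ^+ e) <= N`!%:R * (A * (M ^_ e)%:R).
  by rewrite ler_wpM2l//; lra.
have : N`!%:R * (A * M%:R ^+ e - p.@[fun i => (b i)%:R]) <=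
    N`!%:R * (A * M%:R ^+ e - eps * M%:R ^+ e).
  by rewrite ler_wpM2l//; lra.
lra.
Qed.

End Polya.

(** * Monomials in finitely many of the variables *)

Lemma monomXE i k j : monomX i k j = (k * (i == j))%N.
Proof.
rewrite /monomX /expcmn; case: k => [|k]; first by rewrite onecmE.
elim: k => [|k IHk] /=; first by rewrite ucmE mul1n.
by rewrite mulcmE ucmE IHk mulSn.
Qed.

Section MonomOf.
Variable n : nat.
Implicit Types a b : 'X_{1..n}.

Lemma monom_of_coef a k : monom_of a k = (\sum_(i < n) a i * (val i == k))%N.
Proof.
rewrite /monom_of (big_morph (fun m : monom => m k) (id1 := 0%N) (op1 := addn)).
- by apply: eq_bigr => i _; rewrite monomXE.
- by move=> m1 m2; rewrite mulcmE.
- by rewrite onecmE.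
Qed.

Lemma monom_of_ord a (i : 'I_n) : monom_of a i = a i.
Proof.
rewrite monom_of_coef (bigD1 i)//= eqxx muln1 big1 ?addn0// => j ji.
by rewrite [_ == _](negbTE ji) muln0.
Qed.

Lemma monom_of_big a k : (n <= k)%N -> monom_of a k = 0%N.
Proof.
move=> le_nk; rewrite monom_of_coef big1 => // i _; rewrite -[_ == _]/(val i == k).
by rewrite ltn_eqF ?muln0// (leq_trans (ltn_ord i)).
Qed.

Lemma monom_of_inj : injective (@monom_of n).
Proof. by move=> a b ab; apply/mnmP => i; rewrite -!monom_of_ord ab. Qed.

Lemma monom_ofP (m : monom) : (forall k, (n <= k)%N -> m k = 0%N) ->
  exists a, m = monom_of a.
Proof.
move=> m0; exists [multinom m i | i < n]; apply/eqP/cmP => k.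
have [le_nk|lt_kn] := leqP n k; first by rewrite monom_of_big ?m0.
by rewrite -[k]/(val (Ordinal lt_kn)) monom_of_ord mnmE.
Qed.

Lemma monom_ofD a b : monom_of (a + b) = monom_mul (monom_of a) (monom_of b).
Proof.
apply/eqP/cmP => k; rewrite mulcmE !monom_of_coef -big_split/=.
by apply: eq_bigr => i _; rewrite mnmDE mulnDl.
Qed.

Lemma finsupp_monom_of a :
  perm_eq (finsupp (monom_of a)) [seq val i | i <- enum 'I_n & a i != 0%N].
Proof.
apply: uniq_perm; rewrite ?fset_uniq//.
  by rewrite map_inj_uniq; [rewrite filter_uniq// enum_uniq | exact: val_inj].
move=> k; rewrite -cmE_neq0.
have [le_nk|lt_kn] := leqP n k.
  rewrite monom_of_big//=; apply/esym/negbTE/mapP => -[i _ kE].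
  by move: le_nk; rewrite kE leqNgt ltn_ord.
rewrite -[k]/(val (Ordinal lt_kn)) monom_of_ord mem_map; last exact: val_inj.
by rewrite mem_filter mem_enum andbT.
Qed.

End MonomOf.

Definition exponents (m : monom) : seq nat := [seq m i | i <- finsupp m].

Lemma exponents_monom_of n (a : 'X_{1..n}) :
  perm_eq (exponents (monom_of a)) [seq k <- a | k != 0%N].
Proof.
apply: (perm_trans (perm_map _ (finsupp_monom_of a))).
rewrite -map_comp.
have -> : val a = [seq a i | i <- enum 'I_n] :> seq nat.
  rewrite -[LHS](map_tnth_enum a); apply: eq_map => i; exact: mnm_tnth.
rewrite [X in perm_eq _ X]filter_map (eq_map (g := a)) ?perm_refl// => i /=.
exact: monom_of_ord.
Qed.

Lemma monom_deg_monom_of n (a : 'X_{1..n}) : monom_deg (monom_of a) = mdeg a.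
Proof.
rewrite /monalg.mdeg -(big_map _ xpredT id) -/(exponents _).
rewrite (perm_big _ (exponents_monom_of a))/= big_filter big_mkcond/=.
by rewrite /mdeg; apply: eq_bigr => -[|k].
Qed.

Lemma leq_finsupp (m : monom) : exists n, forall k, (n <= k)%N -> m k = 0%N.
Proof.
exists (\max_(i <- finsupp m) i.+1)%N => k le_k.
apply/eqP; rewrite cmE_eq0; apply: contraL le_k => km; rewrite -ltnNge.
by rewrite (big_fsetD1 k)//= leq_max leqnn.
Qed.

(** * Truncation to finitely many variables *)

Section Truncation.
Variables (R : realType) (n : nat).
Implicit Types (f g : fpseries R) (p q : {mpoly R[n]}).

(** A relational form of truncation: the defining sum of [ps_trunc] is finite
    only for series with finitely many monomials in [n] variables, whereas this
    form is compatible with the ring operations without any such condition. *)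
Definition truncates p f := forall a, p@_a = f (monom_of a).

Lemma fpsumE f g m : (f + g) m = f m + g m. Proof. by []. Qed.

Lemma fpmulE f g m : (f * g) m =
  \sum_(p \in [set p : monom * monom | monom_mul p.1 p.2 = m]) f p.1 * g p.2.
Proof. by []. Qed.

Lemma truncates_const (c : R) : truncates c%:MP c%:A.
Proof.
move=> a; rewrite mcoeffC [RHS]/(c * (_ == _)%:R); congr (_ * _%:R).
suff -> : monom1 = monom_of (0%MM : 'X_{1..n}) by rewrite (inj_eq (@monom_of_inj n)).
apply/eqP/cmP => k; rewrite onecmE monom_of_coef big1// => i _.
by rewrite mnm0E.
Qed.

Lemma truncatesD p q f g : truncates p f -> truncates q g -> truncates (p + q) (f + g).
Proof. by move=> pf qg a; rewrite mcoeffD pf qg fpsumE. Qed.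

(** The factors of a monomial in the first [n] variables involve only these
    variables, so both products range over the same pairs. *)
Lemma truncatesM p q f g : truncates p f -> truncates q g -> truncates (p * q) (f * g).
Proof.
move=> pf qg a; rewrite mcoeffM fpmulE.
pose B := 'X_{1..n < (mdeg a).+1}.
pose r := [seq (monom_of k.1, monom_of k.2) |
  k : B * B <- enum {: B * B} & a == (k.1 + k.2)%MM].
have r_uniq : uniq r.
  rewrite map_inj_uniq; first exact: (filter_uniq _ (enum_uniq _)).
  by move=> [k1 k2] [l1 l2] [/monom_of_inj/val_inj-> /monom_of_inj/val_inj->].
rewrite (fsbigE r)//; last 2 first.
- move=> _ /= /mapP[k + ->] /=; rewrite mem_filter => /andP[/eqP aE _].
  by rewrite -monom_ofD -aE.
- move=> [m1 m2] /= m12 /negP[].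
  have m_big k : (n <= k)%N -> (m1 k = 0 /\ m2 k = 0)%N.
    move=> /(monom_of_big a); rewrite -m12 mulcmE => /eqP.
    by rewrite addn_eq0 => /andP[/eqP-> /eqP->].
  have [|a1 m1E] := monom_ofP (n := n) (m := m1); first by move=> k /m_big[].
  have [|a2 m2E] := monom_ofP (n := n) (m := m2); first by move=> k /m_big[].
  have aE : a = (a1 + a2)%MM by apply: (@monom_of_inj n); rewrite monom_ofD -m1E -m2E.
  have a1_lt : (mdeg a1 < (mdeg a).+1)%N by rewrite ltnS aE mdegD leq_addr.
  have a2_lt : (mdeg a2 < (mdeg a).+1)%N by rewrite ltnS aE mdegD leq_addl.
  apply/mapP; exists (BMultinom a1_lt, BMultinom a2_lt); last by rewrite m1E m2E.
  by rewrite mem_filter mem_enum andbT; apply/eqP.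
rewrite big_map big_filter_cond big_enum_cond/=.
apply: eq_big => [k|k _]; last by rewrite pf qg.
rewrite [X in _ && X](_ : _ = (a == (k.1 + k.2)%MM)) ?andbb//.
rewrite -(inj_eq (@monom_of_inj n)) monom_ofD eq_sym.
by apply/idP/eqP => [|kE]; rewrite in_setE.
Qed.


Lemma truncates_psum k : (0 < k)%N -> truncates (\sum_(i < n) 'X_i ^+ k) (psum k).
Proof.
move=> k_gt0 a; rewrite raddf_sum/=; under eq_bigr do rewrite mcoeffXn.
rewrite /psum; case: asboolP => [[j jE]|nE].
  have lt_jn : (j < n)%N.
    rewrite ltnNge; apply/negP => le_nj.
    have := monom_of_big a le_nj; rewrite jE monomXE eqxx muln1 => k0.
    by rewrite k0 in k_gt0.
  have aE : a = (U_(Ordinal lt_jn) *+ k)%MM.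
    apply/mnmP => i; rewrite -monom_of_ord jE monomXE mulmnE mnm1E mulnC.
    by congr (_ * _)%N.
  rewrite (bigD1 (Ordinal lt_jn))//= aE eqxx big1 ?addr0// => i ij.
  case: eqP => // /mnmP/(_ i); rewrite !mulmnE !mnm1E eqxx eq_sym (negbTE ij) mul1n.
  by move=> k0; rewrite k0 in k_gt0.
rewrite big1// => i _; case: eqP => // aE; case: nE; exists i.
apply/eqP/cmP => l; rewrite monomXE monom_of_coef -aE (bigD1 i)//= big1 => [|j ji].
  by rewrite addn0 mulmnE mnm1E eqxx mul1n.
by rewrite mulmnE mnm1E eq_sym (negbTE ji).
Qed.

Lemma sym_sumXn k : \sum_(i < n) 'X_i ^+ k \is @symmetric n R.
Proof.
apply/issymP => s; rewrite raddf_sum/=.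
rewrite [RHS](reindex_inj (@perm_inj _ s))/=; apply: eq_bigr => i _.
by rewrite rmorphXn/= /msym mmapX mmap1U.
Qed.

(** A monomial with a variable of index at least [n] vanishes at [x], so only
    the monomials of [p] contribute to the infinite sum. *)
Lemma ps_eval_truncates p g (x : {fsfun nat -> R with 0}) : truncates p g ->
  (forall k, (n <= k)%N -> x k = 0) -> ps_eval g x = p.@[fun i => x i].
Proof.
move=> pg x0; pose r := [seq monom_of a | a <- msupp p].
have r_uniq : uniq r by rewrite map_inj_uniq ?msupp_uniq//; exact: monom_of_inj.
rewrite /ps_eval (fsbigE r)//; last first.
  move=> m _ mr; have [/monom_ofP[a mE]|] := pselect (forall k, (n <= k)%N -> m k = 0%N).
    rewrite mE -pg (eqP (_ : p@_a == 0)) ?mul0r// mcoeff_eq0.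
    by apply: contraNN mr => ap; rewrite mE map_f.
  move=> /existsNP[k /not_implyP[le_nk /eqP mk]].
  rewrite (big_fsetD1 k) -?cmE_neq0//= x0// expr0n (negbTE mk).
  by rewrite mul0r mulr0.
rewrite mevalE big_map.
under eq_bigl do rewrite in_setT.
apply: eq_bigr => a _; rewrite pg; congr (_ * _).
rewrite (perm_big _ (finsupp_monom_of a))/= big_map big_filter big_enum_cond/=.
rewrite big_mkcond/=; apply: eq_bigr => i _; rewrite monom_of_ord.
by case: eqP => // ->.
Qed.

End Truncation.

(** * Symmetric functions as combinations of monomial symmetric functions *)

Lemma perm_eq_filter_neq0 (s t : seq nat) : size s = size t ->
  perm_eq [seq k <- s | k != 0%N] [seq k <- t | k != 0%N] -> perm_eq s t.
Proof.
have splitE u : perm_eq u ([seq k <- u | k != 0%N] ++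
    nseq (size u - size [seq k <- u | k != 0%N]) 0%N).
  rewrite perm_sym (perm_trans _ (permEl (perm_filterC (fun k => k != 0%N) u)))//.
  rewrite perm_cat2l; set v := filter (predC _) u.
  have /all_pred1P vE : all (pred1 0%N) v.
    by apply/allP => k; rewrite mem_filter /= negbK => /andP[].
  rewrite vE -(perm_size (permEl (perm_filterC (fun k => k != 0%N) u))) size_cat.
  by rewrite addKn perm_refl.
move=> st perm_st; rewrite (perm_trans (splitE s))// perm_sym (perm_trans (splitE t))//.
by rewrite st (perm_size perm_st) perm_cat2r perm_sym.
Qed.

Section SymmetricSeries.
Variable R : realType.
Implicit Types (f g : fpseries R).

Lemma symfun_truncates n g : symfun g ->
  exists2 p : {mpoly R[n]}, p \is symmetric & truncates p g.
Proof.
elim=> [c|k k_gt0|{}f h _ [p ps pf] _ [q qs qh]|{}f h _ [p ps pf] _ [q qs qh]].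
- exists c%:MP; last exact: truncates_const.
  by apply/issymP => s; rewrite /msym mmapC.
- by exists (\sum_(i < n) 'X_i ^+ k); [exact: sym_sumXn | exact: truncates_psum].
- by exists (p + q); [exact: rpredD | exact: truncatesD].
- by exists (p * q); [exact: rpredM | exact: truncatesM].
Qed.

(** Both monomials live in finitely many variables, where the truncation of
    [g] is a symmetric polynomial. *)
Lemma symfun_exponents g m1 m2 : symfun g ->
  perm_eq (exponents m1) (exponents m2) -> g m1 = g m2.
Proof.
move=> g_sym m12; have [n1 m1_n] := leq_finsupp m1; have [n2 m2_n] := leq_finsupp m2.
pose n := maxn n1 n2.
have [k|a1 m1E] := monom_ofP (n := n) (m := m1).
  by rewrite geq_max => /andP[/m1_n].
have [k|a2 m2E] := monom_ofP (n := n) (m := m2).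
  by rewrite geq_max => /andP[_ /m2_n].
have [p p_sym pg] := symfun_truncates n g_sym.
have /tuple_permP[s sE] : perm_eq a1 a2.
  apply: perm_eq_filter_neq0; first by rewrite !size_tuple.
  apply: perm_trans (exponents_monom_of a2); rewrite -m2E.
  by apply: perm_trans m12; rewrite perm_sym m1E exponents_monom_of.
rewrite m1E m2E -!pg -(msym_coeff a2 s p_sym); congr (_@__).
apply/val_inj/val_inj => /=; rewrite sE.
by apply: eq_map => i; rewrite -mnm_tnth.
Qed.

Lemma fpmul_neq0 f g m : (f * g) m != 0 ->
  exists m1 m2, [/\ m = monom_mul m1 m2, f m1 != 0 & g m2 != 0].
Proof.
apply: contraTP => fg0; rewrite negbK fpmulE fsbig1// => -[m1 m2] /= m12.
apply/eqP; apply: contra_notT fg0; rewrite mulf_eq0 negb_or => /andP[f1 g2].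
by exists m1, m2.
Qed.

Lemma ps_homogM d e f g : ps_homog d f -> ps_homog e g -> ps_homog (d + e) (f * g).
Proof.
move=> fd ge m /fpmul_neq0[m1 [m2 [-> /fd <- /ge <-]]].
exact: mdegM.
Qed.

Lemma ps_evenM f g : ps_even f -> ps_even g -> ps_even (f * g).
Proof.
move=> fE gE m /fpmul_neq0[m1 [m2 [-> /fE f1 /gE g2]]] i.
by rewrite mulcmE oddD negb_add (negbTE (f1 i)) (negbTE (g2 i)).
Qed.

Lemma psum_neq0 k m : psum k m != 0 :> R -> exists i, m = monomX i k.
Proof. by rewrite /psum; case: asboolP => //; rewrite eqxx. Qed.

Lemma monom_deg_X i k : monom_deg (monomX i k) = k.
Proof.
rewrite (mdegEw (d := [fset i]%fset)) ?big_seq_fset1 ?monomXE ?eqxx ?muln1//.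
apply/fsubsetP => j; rewrite -cmE_neq0 monomXE inE [j == i]eq_sym.
by case: (i == j); rewrite ?muln0.
Qed.

Lemma ps_homog_psum k : ps_homog k (psum k : fpseries R).
Proof. by move=> m /psum_neq0[i ->]; rewrite monom_deg_X. Qed.

Lemma ps_even_psum2 : ps_even (psum 2 : fpseries R).
Proof. by move=> m /psum_neq0[i ->] j; rewrite monomXE oddM. Qed.

Lemma ps_homog_psum2X d k f : ps_homog d f -> ps_homog (k * 2 + d) (psum 2 ^+ k * f).
Proof.
move=> fd; elim: k => [|k IHk]; first by rewrite mul1r.
by rewrite exprS -mulrA mulSn -addnA; apply: ps_homogM => //; exact: ps_homog_psum.
Qed.

Lemma ps_even_psum2X k f : ps_even f -> ps_even (psum 2 ^+ k * f).
Proof.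
move=> fE; elim: k => [|k IHk]; first by rewrite mul1r.
by rewrite exprS -mulrA; apply: ps_evenM => //; exact: ps_even_psum2.
Qed.

Lemma symfun_psum2X k f : symfun f -> symfun (psum 2 ^+ k * f).
Proof.
move=> f_sym; elim: k => [|k IHk]; first by rewrite mul1r.
by rewrite exprS -mulrA; apply: symfun_mul => //; exact: symfun_psum.
Qed.

Lemma truncates_psum2X n k f (p : {mpoly R[n]}) : truncates p f ->
  truncates ((\sum_(i < n) 'X_i ^+ 2) ^+ k * p) (psum 2 ^+ k * f).
Proof.
move=> pf; elim: k => [|k IHk]; first by rewrite !mul1r.
by rewrite !exprS -!mulrA; apply: truncatesM => //; exact: truncates_psum.
Qed.

Lemma monom_deg_exponents m : monom_deg m = sumn (exponents m).
Proof. by rewrite sumnE big_map. Qed.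

(** A partition of [D] has at most [D] parts, each at most [D]. *)
Lemma partitions_finite D : exists L : seq (seq nat),
  [/\ uniq L, {in L, forall la, is_partition la} &
      forall la, is_partition la -> sumn la = D -> la \in L].
Proof.
pose L := undup [seq [seq val i | i <- val t] | t <- enum {: {bseq D of 'I_D.+1}}].
exists [seq la <- L | is_partition la].
split=> [|la|la la_part laD]; rewrite ?filter_uniq ?undup_uniq//.
  by rewrite mem_filter => /andP[].
rewrite mem_filter la_part mem_undup/=.
have le_la k : k \in la -> (k <= sumn la)%N.
  by move=> kla; rewrite sumnE (big_rem k)//= leq_addr.
have size_la : (size la <= sumn la)%N.
  have : all (leq 1) la.
    apply/allP => k kla; rewrite lt0n; apply: contraTneq kla => ->.
    by case/andP: la_part.
  by elim: la {la_part laD le_la} => //= k la IHla /andP[k_gt0 /IHla]; lia.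
have sz : (size [seq inord k : 'I_D.+1 | k <- la] <= D)%N by rewrite size_map -laD.
apply/mapP; exists (Bseq sz); first by rewrite mem_enum.
rewrite /= -map_comp map_id_in// => k /le_la; rewrite laD => kD /=.
by rewrite inordK.
Qed.

Definition partition_monom (la : seq nat) : monom := monom_of (Multinom (in_tuple la)).

Lemma exponents_partition_monom la : is_partition la ->
  perm_eq (exponents (partition_monom la)) la.
Proof.
case/andP=> _ la0; rewrite (perm_trans (exponents_monom_of _))//=.
have /all_filterP -> : all (fun k => k != 0%N) la; last by rewrite perm_refl.
by apply/allP => k kla; apply: contraNneq la0 => <-.
Qed.

Lemma exponents_gt0 m : 0%N \notin exponents m.
Proof. by apply/mapP => -[i im /eqP]; rewrite eq_sym cmE_eq0 im. Qed.

Lemma fpsum_bigE (I : Type) (r : seq I) (F : I -> fpseries R) m :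
  (\sum_(i <- r) F i) m = \sum_(i <- r) F i m.
Proof. exact: (big_morph (fun g : fpseries R => g m) (id1 := 0) (op1 := +%R)). Qed.

Lemma fpscaleE (c : R) g m : (c *: g) m = c * g m. Proof. by []. Qed.

(** The coefficient of [g] at [m] depends only on the decreasing
    rearrangement of the exponents of [m], which is a partition of [D]. The
    coefficients of the expansion are values of [g], which transfers bounds and
    signs between [g] and its expansion. *)
Lemma even_symfun_expansion D g : symfun g -> ps_homog D g -> ps_even g ->
  exists2 s : seq (R * seq nat),
    {in s, forall c, [/\ exists m, c.1 = g m, is_partition c.2
                       & all (fun i => ~~ odd i) c.2]}
    & g = \sum_(c <- s) c.1 *: monomial_symfun c.2.
Proof.
move=> g_sym g_homog g_even; have [L [L_uniq L_part LP]] := partitions_finite D.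
pose ev := all (fun i => ~~ odd i).
exists [seq (g (partition_monom la), la) | la <- L & ev la].
  move=> _ /mapP[la + ->] /=; rewrite mem_filter => /andP[la_ev /L_part la_part].
  by split=> //; exists (partition_monom la).
apply/funext => m; rewrite fpsum_bigE big_map big_filter.
pose la0 := sort geq (exponents m).
have la0_perm : perm_eq la0 (exponents m) by rewrite perm_sort.
have la0_part : is_partition la0.
  rewrite /is_partition mem_sort exponents_gt0 andbT; apply: sort_sorted.
  by move=> i j; exact: leq_total.
(* The only partition whose monomial symmetric function contains m is la0. *)
transitivity (\sum_(la <- L | ev la) (if la == la0 then g m else 0)); last first.
  rewrite big_seq_cond [RHS]big_seq_cond; apply: eq_bigr => la /andP[/L_part la_part _].
  rewrite fpscaleE /monomial_symfun; have [->|/eqP la_la0] := eqVneq la la0.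
    rewrite perm_sym la0_perm mulr1; apply: symfun_exponents => //.
    by rewrite perm_sym (perm_trans (exponents_partition_monom la0_part)).
  case: (boolP (perm_eq _ _)) => [m_la|]; last by rewrite mulr0.
  case: la_la0; apply: (sorted_eq (leT := geq)).
  - by move=> i j k /= ij jk; apply: leq_trans jk ij.
  - by move=> i j; rewrite andbC => /anti_leq.
  - by case/andP: la_part.
  - by case/andP: la0_part.
  - by rewrite perm_sym (perm_trans la0_perm).
rewrite -big_mkcondr; have [gm|gm] := eqVneq (g m) 0; first by rewrite gm big1.
have la0_L : la0 \in L.
  by rewrite LP// (perm_sumn la0_perm) -monom_deg_exponents g_homog.
have la0_ev : ev la0.
  rewrite /ev (perm_all _ la0_perm); apply/allP => _ /mapP[i _ ->].
  exact: g_even.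
rewrite -big_filter (_ : [seq _ <- _ | _] = [:: la0]) ?big_seq1//.
apply/perm_small_eq => //; apply: uniq_perm; rewrite ?filter_uniq// => la.
rewrite mem_filter inE; case: eqP => [->|]; rewrite ?andbF//=.
by rewrite la0_ev.
Qed.

(** This bound on the coefficients makes the exponent in [uniform_Polya]
    independent of the number of variables. *)
Lemma symfun_bounded D f : symfun f -> ps_homog D f -> ps_even f ->
  exists2 A : R, 0 <= A & forall m, f m <= A.
Proof.
move=> f_sym f_homog f_even.
have [s _ ->] := even_symfun_expansion f_sym f_homog f_even.
exists (\sum_(c <- s) `|c.1|); first exact: sumr_ge0.
move=> m; rewrite fpsum_bigE; apply: ler_sum => c _.
rewrite fpscaleE /monomial_symfun.
by case: (perm_eq _ _); rewrite ?mulr1 ?mulr0// ler_norm.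
Qed.

Definition half_mnm n (a : 'X_{1..n}) : 'X_{1..n} := [multinom (a i)./2 | i < n].

Lemma half_mnmK n (a : 'X_{1..n}) : (forall i, ~~ odd (a i)) -> (half_mnm a *+ 2)%MM = a.
Proof.
move=> a_even; apply/mnmP => i; rewrite mulmnE mnmE muln2.
exact: even_halfK.
Qed.

(** A term [c X^(2a)] with [c >= 0] is the square of [sqrt c X^a]. *)
Lemma any_dim_sos_even f : (forall m, 0 <= f m) -> ps_even f -> any_dim_sos f.
Proof.
move=> f_ge0 f_even n _; rewrite /ps_trunc; set r := finite_support _ _ _.
exists [seq Num.sqrt (f (monom_of m)) *: 'X_[half_mnm m] | m <- r].
rewrite big_map; apply: eq_bigr => m _; rewrite exprZn sqr_sqrtr// mpolyXn.
have [->|fm] := eqVneq (f (monom_of m)) 0; first by rewrite !scale0r.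
by rewrite half_mnmK// => i; rewrite -monom_of_ord f_even.
Qed.

End SymmetricSeries.

(** * Even polynomials as polynomials in the squares of the variables *)

Section Squares.
Variables (R : realType) (n : nat).
Implicit Types (p q : {mpoly R[n]}).

Definition sqX : n.-tuple {mpoly R[n]} := [tuple 'X_i ^+ 2 | i < n].

Lemma mpolyX_sqX a : 'X_[a] \mPo sqX = 'X_[a *+ 2] :> {mpoly R[n]}.
Proof.
rewrite comp_mpolyX mpolyXE_id; apply: eq_bigr => i _.
by rewrite tnth_mktuple mulmnE mulnC exprM.
Qed.

Lemma mcoeff_comp_sqX q a : (q \mPo sqX)@_(a *+ 2) = q@_a.
Proof.
rewrite comp_mpolyEX raddf_sum/= [in RHS](mpolyE q) [RHS]raddf_sum/=.
apply: eq_bigr => m _; rewrite mpolyX_sqX !mcoeffZ !mcoeffX.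
congr (_ * (nat_of_bool _)%:R).
apply/eqP/eqP => [/mnmP ma|->//]; apply/mnmP => i.
by have := ma i; rewrite !mulmnE; lia.
Qed.

Lemma comp_sumX_sqX : (\sum_(i < n) 'X_i) \mPo sqX = \sum_(i < n) 'X_i ^+ 2.
Proof.
rewrite raddf_sum/=; apply: eq_bigr => i _.
by rewrite mpolyX_sqX mpolyXn.
Qed.

Lemma even_mpolyP p : (forall a, p@_a != 0 -> forall i, ~~ odd (a i)) ->
  exists q, p = q \mPo sqX.
Proof.
move=> p_even; exists (\sum_(m <- msupp p) p@_m *: 'X_[half_mnm m]).
rewrite [LHS]mpolyE raddf_sum/= big_seq [RHS]big_seq; apply: eq_bigr => m mp.
rewrite comp_mpolyZ mpolyX_sqX half_mnmK//; apply: p_even.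
by rewrite -mcoeff_msupp.
Qed.

Lemma meval_comp_sqX q (x : 'I_n -> R) : (q \mPo sqX).@[x] = q.@[fun i => x i ^+ 2].
Proof.
rewrite comp_mpoly_meval; apply: meval_eq => i.
by rewrite tnth_mktuple rmorphXn/= mevalXU.
Qed.

Lemma sqrt_point (y : 'I_n -> R) : exists x : {fsfun nat -> R with 0},
  (forall i : 'I_n, x i = Num.sqrt (y i)) /\ (forall k, (n <= k)%N -> x k = 0).
Proof.
pose F k := if insub k is Some i then Num.sqrt (y i) else 0.
exists [fsfun k in [fset k | k in iota 0 n]%fset => F k | 0].
split=> [i|k le_nk]; rewrite fsfun_fun inE/= mem_iota/= add0n.
  by rewrite ltn_ord /F valK.
by rewrite ltnNge le_nk.
Qed.

End Squares.

(** * Positivity after multiplication by a power of p_2 *)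

Theorem corollary3p3 (R : realType) (f : fpseries R) (d : nat) (eps : R)
  (f_sym : symfun f) (f_homog : ps_homog d f) (f_even : ps_even f)
  (eps_gt0 : 0 < eps)
  (f_ge : forall x : {fsfun nat -> R with 0},
     ps_eval (psum 2) x = 1 -> eps <= ps_eval f x) :
  exists k : nat,
    [/\ (0 < k)%N,
        exists2 s : seq (R * seq nat),
          {in s, forall c, [/\ 0 <= c.1, is_partition c.2
                             & all (fun i => ~~ odd i) c.2]}
          & psum 2 ^+ k * f = \sum_(c <- s) c.1 *: monomial_symfun c.2
      & any_dim_sos (psum 2 ^+ k * f)].
Proof.
have [A A_ge0 f_le] := symfun_bounded f_sym f_homog f_even.
pose e := d./2; pose k := (Num.bound (A * (e ^ 2)%:R / eps)).+1.
have k_large : A * (e ^ 2)%:R <= eps * k%:R.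
  rewrite -ler_pdivrMl// mulrC ltW// (lt_le_trans (archi_boundP _))//.
    by rewrite divr_ge0 ?mulr_ge0// ltW.
  by rewrite ler_nat.
have g_even := ps_even_psum2X (k := k) f_even.
have g_ge0 m : 0 <= (psum 2 ^+ k * f) m.
  have [->//|gm] := eqVneq ((psum 2 ^+ k * f) m) 0.
  (* The number n of variables depends on m; k does not depend on n. *)
  have [n /monom_ofP[a mE]] := leq_finsupp m.
  have [p _ pf] := symfun_truncates n f_sym.
  have [|q pE] := @even_mpolyP _ _ p.
    by move=> b; rewrite pf => /f_even fb i; rewrite -monom_of_ord.
  have qE b : q@_b = f (monom_of (b *+ 2)%MM) by rewrite -pf pE mcoeff_comp_sqX.
  have q_homog : q \is e.-homog.
    apply/dhomogP => b; rewrite mcoeff_msupp qE => /f_homog.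
    by rewrite monom_deg_monom_of mdegMn /e => <-; rewrite muln2 doubleK.
  rewrite mE -(truncates_psum2X _ pf) pE -comp_sumX_sqX -rmorphXn -rmorphM/=.
  rewrite -(half_mnmK (a := a)); last by move=> i; rewrite -monom_of_ord -mE g_even.
  rewrite mcoeff_comp_sqX.
  apply: (uniform_Polya (A := A) (eps := eps) q_homog) => // [b|y y_ge0 y1].
    by rewrite qE.
  have [x [xE x0]] := sqrt_point y.
  have xy : (fun i : 'I_n => x i ^+ 2) =1 y by move=> i; rewrite xE sqr_sqrtr.
  have := f_ge x; rewrite (ps_eval_truncates pf x0) pE meval_comp_sqX (meval_eq _ xy).
  apply; rewrite (ps_eval_truncates (@truncates_psum R n 2 isT) x0).
  rewrite -comp_sumX_sqX meval_comp_sqX raddf_sum/= -y1; apply: eq_bigr => i _.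
  by rewrite mevalXU xy.
exists k; split=> //; last exact: any_dim_sos_even.
have [s sP sE] := even_symfun_expansion (symfun_psum2X k f_sym)
  (ps_homog_psum2X (k := k) f_homog) g_even.
by exists s => // c /sP[[m ->] c_part c_even]; split.
Qed.
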